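(* Let $Y,U\in\mathbb{R}_+^{(N+1)\times m}$ with $\sum_{j=1}^m U_{0j}>0$, and let $F(h)=\mathcal{I}(Y\|T(h)U)$ for $h\in\mathcal{H}=\mathbb{R}_+^{N+1}$. Let the initial point $h^0\in\mathcal{H}$ be chosen such that $F(h^0)<\infty$, and define the sequence of iterates $(h^t)_{t\ge 0}$ recursively by $$h^{t+1}_k=\frac{h^t_k}{\sum_{l=0}^{N-k}\sum_{j=1}^m U_{lj}}\sum_{j=1}^m\sum_{i=k}^{N}\frac{Y_{ij}U_{i-k,j}}{\sum_{p=0}^{i} h^t_pU_{i-p,j}},\qquad k=0,\dots,N.$$ Then the sequence of iterates $h^t$ converges to a limit $h^\infty$ which minimizes $h\mapsto \mathcal{I}(Y\|T(h)U)$ over $\mathcal{H}$.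
   Context: $N\ge 0$ and $m\ge 1$ are integers. Rows of $Y,U$ are indexed by $0,\dots,N$, columns by $1,\dots,m$; $U_{ij}:=0$ for $i<0$. For $h=(h_0,\dots,h_N)^\top\in\mathbb{R}_+^{N+1}$ (nonnegative entries), $T(h)$ is the $(N+1)\times(N+1)$ lower triangular Toeplitz matrix with entries $T(h)_{ik}=h_{i-k}$ for $i\ge k$ and $0$ otherwise, so $(T(h)U)_{ij}=\sum_{k=0}^i h_kU_{i-k,j}$. For nonnegative matrices $A,B$ of the same size, the I-divergence is $\mathcal{I}(A\|B)=\sum_{ij}\big(A_{ij}\log\frac{A_{ij}}{B_{ij}}-A_{ij}+B_{ij}\big)$ if $A_{ij}=0$ whenever $B_{ij}=0$, and $\mathcal{I}(A\|B)=+\infty$ otherwise, with the conventions $\frac00=0$, $0\log 0=0$. The convention $\frac00=0$ is also used in the recursion.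
   Formalization: If h^0 has zero entries the limit need not minimize over H (N=m=1, U=(1,1), Y=(1,5), h^0=(1,0)); so h^∞ is shown to minimize over the h in H vanishing wherever h^0 does, and over all of H when every entry of h^0 is positive; convergence is kept for all h^0. *)

(* Defs.v *)
From HB Require Import structures.
From mathcomp Require Import all_boot all_order all_algebra.
From mathcomp Require Import all_classical all_reals all_analysis.

Set Implicit Arguments.
Unset Strict Implicit.
Unset Printing Implicit Defensive.

Import Order.TTheory GRing.Theory Num.Theory.
Import numFieldNormedType.Exports.

Local Open Scope classical_set_scope.
Local Open Scope ring_scope.

Definition nonneg_mx (R : realType) (p q : nat) (A : 'M[R]_(p, q)) : Prop :=
  forall i j, 0 <= A i j.

(* All ordinal indices range over 0, ..., N.  Every [inord (i - k)] occurs
   under the condition [k <= i], so that the truncated subtraction is exact and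
   [inord] is the identity. *)
Definition toeplitz (R : realType) (N : nat) (h : 'cV[R]_N.+1) : 'M[R]_N.+1 :=
  \matrix_(i, k) (if (k <= i)%N then h (inord (i - k)) 0 else 0).

(* The conventions [0 / 0 = 0] and [0 * log 0 = 0] hold for the library
   operations: [0^-1 = 0] and [ln x = 0] for [x <= 0].  The junk value of
   [a / 0] for [a > 0] is never used here, the divergence being [+oo] in that
   case. *)
Definition idiv (R : realType) (p q : nat) (A B : 'M[R]_(p, q)) : \bar R :=
  if [forall i, forall j, (B i j == 0) ==> (A i j == 0)]
  then (\sum_i \sum_j (A i j * ln (A i j / B i j) - A i j + B i j))%:E
  else +oo%E.

Definition objective (R : realType) (N m : nat) (Y U : 'M[R]_(N.+1, m))
    (h : 'cV[R]_N.+1) : \bar R :=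
  idiv Y (toeplitz h *m U).

Definition update (R : realType) (N m : nat) (Y U : 'M[R]_(N.+1, m))
    (h : 'cV[R]_N.+1) : 'cV[R]_N.+1 :=
  \col_k (h k 0 / (\sum_(l < N.+1 | (l <= N - k)%N) \sum_(j < m) U l j) *
    \sum_(j < m) \sum_(i < N.+1 | (k <= i)%N)
      (Y i j * U (inord (i - k)) j /
        \sum_(p < N.+1 | (p <= i)%N) h p 0 * U (inord (i - p)) j)).

Definition minimizer_over (R : realType) (T : Type) (D : set T)
    (F : T -> \bar R) (x : T) : Prop :=
  D x /\ forall y, D y -> (F x <= F y)%E.

(* The points of the nonnegative orthant vanishing wherever [h0] does; this is
   the whole orthant when all the entries of [h0] are positive.  [update] is
   multiplicative, so every iterate started at [h0] stays in this set, and a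
   limit of the iterates can only be optimal relative to it.  For instance, with
   [N = 1], [m = 1], [U = (1, 1)], [Y = (1, 5)] and [h0 = (1, 0)], the divergence
   at [h0] is finite, the iterates are [(3, 0)] from the first step on, and
   the minimizer over the orthant is [(1, 4)]. *)
Definition reachable (R : realType) (n : nat) (h0 : 'cV[R]_n) : set 'cV[R]_n :=
  [set g | nonneg_mx g /\ forall k, h0 k 0 = 0 -> g k 0 = 0].

(* Main.v *)
Require Import Defs.
From HB Require Import structures.
From mathcomp Require Import all_boot all_order all_algebra.
From mathcomp Require Import all_classical all_reals all_analysis.
From mathcomp Require Import ring lra.

(* Indexing the data by pairs [e = (i, j)], the model is [mean x e = sum_k a e k * x k],
   and the recursion is the EM (Richardson-Lucy) update [x k -> x k * gain x k].  Jensen's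
   inequality for [ln] gives
     sum_k colsum k * kldiv (em x k) (x k) <= divergence x - divergence (em x),
   so successive iterates become arbitrarily close and every cluster point [z] is a fixed
   point.  Jensen's inequality again shows that the weighted divergence of [z] from the
   iterates is nonincreasing; it tends to [0] along a subsequence, hence along the whole
   sequence, which therefore converges to [z].  At the limit [gain z k = 1] where
   [z k != 0], and [gain z k <= 1] where [z k = 0] and [x 0 k != 0], since otherwise the
   [k]-th entry would eventually grow; by convexity these conditions imply optimality. *)

Set Implicit Arguments.
Unset Strict Implicit.
Unset Printing Implicit Defensive.

Import Order.TTheory GRing.Theory Num.Theory.
Import numFieldNormedType.Exports.

Local Open Scope classical_set_scope.
Local Open Scope ring_scope.

(** * Scalar I-divergence and Jensen's inequality *)

Section scalar_divergence.
Context {R : realType}.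
Implicit Types p q r : R.

Definition kldiv p q := p * ln (p / q) - p + q.

Lemma ln_leB1 p : 0 < p -> ln p <= p - 1.
Proof.
by move=> p0; have := @le_ln1Dx R (p - 1); rewrite subrKC; apply; lra.
Qed.

Lemma kldiv0 q : kldiv 0 q = q.
Proof. by rewrite /kldiv mul0r subr0 add0r. Qed.

Lemma kldivxx p : kldiv p p = 0.
Proof.
rewrite /kldiv; have [->|p0] := eqVneq p 0; first by rewrite mul0r subr0 addr0.
by rewrite divff// ln1 mulr0; ring.
Qed.

(** Squared Hellinger bound: [ln_leB1] at the inverse ratio [b / a] of the square roots. It turns
    small divergence into closeness. *)
Lemma kldiv_ge_sqrt p q : 0 <= p -> 0 <= q -> (q = 0 -> p = 0) ->
  (Num.sqrt p - Num.sqrt q) ^+ 2 <= kldiv p q.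
Proof.
move=> p0 q0 qp; rewrite /kldiv; have [->|pn0] := eqVneq p 0.
  by rewrite sqrtr0 mul0r sub0r sqrrN sqr_sqrtr// oppr0 !add0r.
have {}p0 : 0 < p by rewrite lt0r pn0.
have {qp}q0 : 0 < q by rewrite lt0r q0 andbT; apply: contra_neqN pn0 => /eqP/qp ->.
have [a0 b0] : 0 < Num.sqrt p /\ 0 < Num.sqrt q by rewrite !sqrtr_gt0.
have [pE qE] := (sqr_sqrtr (ltW p0), sqr_sqrtr (ltW q0)).
move: (Num.sqrt p) (Num.sqrt q) a0 b0 pE qE => a b a0 b0 <- <-.
have -> : ln (a ^+ 2 / b ^+ 2) = - (ln (b / a) *+ 2).
  by rewrite !ln_div ?posrE ?exprn_gt0// !lnXn//; ring.
have : a ^+ 2 * ln (b / a) <= a ^+ 2 * (b / a - 1).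
  by rewrite ler_wpM2l ?sqr_ge0// ln_leB1// divr_gt0.
have -> : a ^+ 2 * (b / a - 1) = a * b - a ^+ 2 by field; rewrite gt_eqF.
lra.
Qed.

Lemma kldiv_ge0 p q : 0 <= p -> 0 <= q -> (q = 0 -> p = 0) -> 0 <= kldiv p q.
Proof.
by move=> p0 q0 qp; apply: le_trans (kldiv_ge_sqrt p0 q0 qp); exact: sqr_ge0.
Qed.

Lemma kldivB p q r : 0 <= p -> 0 <= q -> 0 <= r ->
  (q = 0 -> p = 0) -> (r = 0 -> p = 0) ->
  kldiv p q - kldiv p r = p * ln (r / q) + (q - r).
Proof.
move=> p0 q0 r0 qp rp; rewrite /kldiv; have [->|pn0] := eqVneq p 0.
  by rewrite !mul0r; ring.
have {}p0 : 0 < p by rewrite lt0r pn0.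
have {qp}q0 : 0 < q by rewrite lt0r q0 andbT; apply: contra_neqN pn0 => /eqP/qp ->.
have {rp}r0 : 0 < r by rewrite lt0r r0 andbT; apply: contra_neqN pn0 => /eqP/rp ->.
by rewrite !ln_div ?posrE//; ring.
Qed.

(** Continuity reaches the boundary [q = 0] because [p] vanishes there too, and [kldiv 0] is the
    identity. *)
Lemma cvg_kldiv p q (u : R^nat) : 0 <= p -> 0 <= q -> (q = 0 -> p = 0) ->
  u @ \oo --> q -> kldiv p (u n) @[n --> \oo] --> kldiv p q.
Proof.
move=> p0 q0 qp uq; have [->|pn0] := eqVneq p 0.
  by rewrite kldiv0; under eq_fun do rewrite kldiv0.
have {}q0 : 0 < q by rewrite lt0r q0 andbT; apply: contra_neqN pn0 => /eqP/qp ->.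
apply: cvgD (uq); apply: cvgB; last exact: cvg_cst.
apply: cvgMr; apply: continuous_cvg; first by apply/continuous_ln/divr_gt0; rewrite// lt0r pn0.
by apply: cvgMr; apply: cvgV => //; rewrite gt_eqF.
Qed.

(** The tangent of [ln] at the mean [M] gives [ln (r i) - ln M <= r i / M - 1], and these upper
    bounds average to zero. Positivity of [r i] is asked only where the weight is positive, which
    admits vanishing coefficients. *)
Lemma jensen_ln (I : finType) (w r : I -> R) :
  (forall i, 0 <= w i) -> (forall i, 0 < w i -> 0 < r i) -> \sum_i w i = 1 ->
  \sum_i w i * ln (r i) <= ln (\sum_i w i * r i).
Proof.
move=> w0 r0 w1; set M := \sum_i w i * r i.
have wr0 i : 0 <= w i * r i.
  have [->|wi] := eqVneq (w i) 0; first by rewrite mul0r.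
  by rewrite mulr_ge0// ltW// r0// lt0r wi w0.
have M0 : 0 < M.
  rewrite lt0r sumr_ge0// andbT; apply/eqP => M0.
  have : \sum_i w i = 0.
    apply: big1 => i _; apply/eqP/negPn/negP => wi.
    have /eqP : w i * r i = 0 by apply: (psumr_eq0P _ M0).
    by rewrite mulf_eq0 (negPf wi) gt_eqF// r0// lt0r wi w0.
  by rewrite w1 => /eqP; rewrite oner_eq0.
rewrite -subr_le0 -[ln M]mul1r -w1 mulr_suml -sumrB.
apply: (@le_trans _ _ (\sum_i (w i * r i / M - w i))); last first.
  by rewrite sumrB w1 -mulr_suml divff ?subrr ?gt_eqF.
apply: ler_sum => i _; have [->|wi] := eqVneq (w i) 0; first by rewrite !mul0r.
have {}ri : 0 < r i by rewrite r0// lt0r wi w0.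
rewrite -mulrBr -ln_div ?posrE// -mulrA -[X in _ - X]mulr1 -mulrBr ler_wpM2l//.
by rewrite ln_leB1// divr_gt0.
Qed.

End scalar_divergence.

(** * One step of the EM update: descent, Fejer monotonicity, convexity *)

Section multiplicative_update.
Context {R : realType} {E I : finType} (a : E -> I -> R) (y : E -> R).
Hypothesis a_ge0 : forall e k, 0 <= a e k.
Hypothesis y_ge0 : forall e, 0 <= y e.
Implicit Types x z : I -> R.

Definition mean x e := \sum_k a e k * x k.

Definition colsum k := \sum_e a e k.

(** The partial derivative of [divergence] in [x k] is [colsum k * (1 - gain x k)]. *)
Definition gain x k := (\sum_e y e * a e k / mean x e) / colsum k.

Definition em x k := x k * gain x k.

Definition divergence x := \sum_e kldiv (y e) (mean x e).

(** The second clause is finiteness of the I-divergence; without it the real-valued [divergence]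
    involves default values. *)
Definition feasible x :=
  (forall k, 0 <= x k) /\ (forall e, mean x e = 0 -> y e = 0).

Hypothesis colsum_gt0 : forall k, 0 < colsum k.

Lemma mean_ge0 x e : (forall k, 0 <= x k) -> 0 <= mean x e.
Proof. by move=> x0; apply: sumr_ge0 => k _; rewrite mulr_ge0. Qed.

Lemma mean_gt0 x e : feasible x -> y e != 0 -> 0 < mean x e.
Proof.
move=> [x0 xy] ye; rewrite lt0r mean_ge0// andbT.
by apply: contra_neqN ye => /eqP/xy.
Qed.

Lemma sum_mean x : \sum_e mean x e = \sum_k colsum k * x k.
Proof. by rewrite exchange_big; apply: eq_bigr => k _; rewrite -mulr_suml. Qed.

Lemma gain_ge0 x k : (forall k, 0 <= x k) -> 0 <= gain x k.
Proof.
move=> x0; rewrite divr_ge0 ?(ltW (colsum_gt0 k))//.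
by apply: sumr_ge0 => e _; rewrite divr_ge0 ?mulr_ge0// mean_ge0.
Qed.

Lemma em_ge0 x k : (forall k, 0 <= x k) -> 0 <= em x k.
Proof. by move=> x0; rewrite mulr_ge0// gain_ge0. Qed.

Lemma gain_gt0 x e k : feasible x -> y e * a e k != 0 -> 0 < gain x k.
Proof.
move=> fx yak; rewrite divr_gt0// lt0r.
have t0 i : 0 <= y i * a i k / mean x i.
  by rewrite divr_ge0 ?mulr_ge0// mean_ge0//; case: fx.
rewrite sumr_ge0// andbT; apply/eqP => S0.
have /eqP : y e * a e k / mean x e = 0 by apply: (psumr_eq0P _ S0).
rewrite mulf_eq0 (negPf yak) invr_eq0 gt_eqF//; apply: mean_gt0 => //.
by apply: contraNneq yak => ->; rewrite mul0r.
Qed.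

(** A zero gain at a feasible point forces [y e * a e k = 0] for all [e], a condition on the data
    alone. *)
Lemma gain_eq0 x k : feasible x -> gain x k = 0 -> forall z, gain z k = 0.
Proof.
move=> fx rx z; rewrite /gain big1 ?mul0r// => e _.
have [->|/(gain_gt0 fx)] := eqVneq (y e * a e k) 0; first by rewrite mul0r.
by rewrite rx ltxx.
Qed.

(** The update annihilates a nonzero [x k] only if [y e * a e k = 0] for all [e], so no mean with
    nonzero [y e] loses a contribution entirely. *)
Lemma feasible_em x : feasible x -> feasible (em x).
Proof.
move=> fx; have x0 := fx.1; have ex0 k := em_ge0 k x0.
split=> // e m0; apply/eqP/negPn/negP => ye.
have := mean_gt0 fx ye; rewrite /mean big1 ?ltxx// => k _.
have /eqP : a e k * em x k = 0.
  by apply: (psumr_eq0P _ m0) => // i _; rewrite mulr_ge0.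
rewrite mulf_eq0 => /orP[/eqP->|]; first by rewrite mul0r.
rewrite mulf_eq0 => /orP[/eqP->|/eqP rk]; first by rewrite mulr0.
have [->|ak] := eqVneq (a e k) 0; first by rewrite mul0r.
by have := gain_gt0 fx (mulf_neq0 ye ak); rewrite rk ltxx.
Qed.

(** E-step form: each [y e] is split among the indices [k] in proportion to their shares
    [a e k * x k] of the mean. *)
Lemma mul_colsum_em x k :
  colsum k * em x k = \sum_e y e * (a e k * x k / mean x e).
Proof.
rewrite /em /gain mulrCA [colsum k * _]mulrC divfK ?gt_eqF// mulr_sumr.
by apply: eq_bigr => e _; ring.
Qed.

Lemma sum_mean_weight x e : feasible x ->
  y e * \sum_k a e k * x k / mean x e = y e.
Proof.
move=> fx; have [->|ye] := eqVneq (y e) 0; first by rewrite mul0r.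
by rewrite -mulr_suml divff ?mulr1// gt_eqF// mean_gt0.
Qed.

Lemma sum_colsum_em x : feasible x -> \sum_k colsum k * em x k = \sum_e y e.
Proof.
move=> fx; under eq_bigr do rewrite mul_colsum_em.
rewrite exchange_big; apply: eq_bigr => e _.
by rewrite -mulr_sumr sum_mean_weight.
Qed.

Lemma divergence_ge0 x : feasible x -> 0 <= divergence x.
Proof.
by move=> [x0 xy]; apply: sumr_ge0 => e _; rewrite kldiv_ge0 ?mean_ge0//; exact: xy.
Qed.

Lemma divergenceB x z : feasible x -> feasible z ->
  divergence x - divergence z =
  \sum_e y e * ln (mean z e / mean x e) +
  \sum_k colsum k * x k - \sum_k colsum k * z k.
Proof.
move=> [x0 xy] [z0 zy]; rewrite -!sum_mean -addrA -!sumrB -big_split/=.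
by apply: eq_bigr => e _; rewrite kldivB ?mean_ge0//; [exact: xy|exact: zy].
Qed.

Lemma divergence_em_le x : feasible x ->
  \sum_k colsum k * kldiv (em x k) (x k) <= divergence x - divergence (em x).
Proof.
move=> fx; have x0 := fx.1; rewrite (divergenceB fx (feasible_em fx)).
(* For each [e] this is the average of [ln (gain x k)] under the splitting weights, to be compared
   with the logarithm of the average gain; the mass terms cancel. *)
have -> : \sum_k colsum k * kldiv (em x k) (x k) =
    \sum_e y e * (\sum_k a e k * x k / mean x e * ln (gain x k)) +
    (\sum_k colsum k * x k - \sum_k colsum k * em x k).
  transitivity (\sum_k (colsum k * em x k * ln (gain x k) +
      (colsum k * x k - colsum k * em x k))).
    apply: eq_bigr => k _; rewrite /kldiv; have [xk0|xk0] := eqVneq (x k) 0.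
      by rewrite /em xk0; ring.
    by rewrite /em [_ / x k]mulrAC divff// mul1r; ring.
  rewrite big_split/= sumrB; congr (_ + _).
  under eq_bigr do rewrite mul_colsum_em mulr_suml.
  rewrite exchange_big/=; apply: eq_bigr => e _; rewrite mulr_sumr.
  by apply: eq_bigr => k _; ring.
rewrite -addrA lerD2r; apply: ler_sum => e _.
have [->|ye] := eqVneq (y e) 0; first by rewrite !mul0r.
rewrite ler_wpM2l//.
have -> : mean (em x) e / mean x e = \sum_k a e k * x k / mean x e * gain x k.
  by rewrite /mean mulr_suml; apply: eq_bigr => k _; rewrite /em; ring.
have mx := mean_gt0 fx ye.
apply: jensen_ln => [k|k|]; first by rewrite divr_ge0 ?mulr_ge0// ltW.
  rewrite pmulr_lgt0 ?invr_gt0// => ax; apply: (@gain_gt0 _ e) => //.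
  by rewrite mulf_neq0//; apply: contraTneq ax => ->; rewrite mul0r ltxx.
by rewrite -mulr_suml divff// gt_eqF.
Qed.

(* A fixed point [z] is its own reweighting, which turns the left-hand side into
   averages of [ln (mean z e / mean x e)] with weights summing to [gain z k],
   that is to [1] wherever [z k != 0]. *)
Lemma em_fejer x z : feasible x -> feasible z -> em z =1 z ->
  (forall k, x k = 0 -> z k = 0) ->
  divergence x - divergence z <=
  \sum_k colsum k * (kldiv (z k) (x k) - kldiv (z k) (em x k)).
Proof.
move=> fx fz zfix xz; have [x0 z0] := (fx.1, fz.1); rewrite divergenceB//.
(* Both masses equal the total of [y], [z] being its own update. *)
have sz : \sum_k colsum k * z k = \sum_k colsum k * em x k.
  rewrite (sum_colsum_em fx) -(sum_colsum_em fz).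
  by apply: eq_bigr => k _; rewrite zfix.
have exz k : em x k = 0 -> z k = 0.
  move=> /eqP; rewrite mulf_eq0 => /orP[/eqP/xz//|/eqP/(gain_eq0 fx)/(_ z) rz].
  by rewrite -zfix /em rz mulr0.
have zr k : z k != 0 -> gain z k = 1.
  by move=> zk; apply: (mulfI zk); rewrite mulr1; exact: zfix.
have -> : \sum_k colsum k * (kldiv (z k) (x k) - kldiv (z k) (em x k)) =
    \sum_k colsum k * z k * ln (gain x k) +
    \sum_k colsum k * x k - \sum_k colsum k * z k.
  rewrite sz -addrA -sumrB -big_split/=; apply: eq_bigr => k _.
  rewrite kldivB ?em_ge0//; [|exact: xz|exact: exz].
  have [zk0|zk0] := eqVneq (z k) 0; first by rewrite zk0; ring.
  have xk0 : x k != 0 by apply: contra_neq zk0 => /xz.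
  by rewrite /em [_ / x k]mulrAC divff// mul1r; ring.
rewrite -!addrA lerD2r.
have -> : \sum_e y e * ln (mean z e / mean x e) =
    \sum_k colsum k * z k *
      \sum_e y e * a e k / mean z e / colsum k * ln (mean z e / mean x e).
  under [RHS]eq_bigr do rewrite mulr_sumr.
  rewrite exchange_big/=; apply: eq_bigr => e _.
  rewrite -[in LHS](sum_mean_weight e fz) mulr_sumr mulr_suml.
  apply: eq_bigr => k _; have [->|ye] := eqVneq (y e) 0.
    by rewrite !(mul0r, mulr0).
  by field; rewrite !gt_eqF// mean_gt0.
apply: ler_sum => k _.
have [->|zk0] := eqVneq (z k) 0; first by rewrite mulr0 !mul0r.
rewrite ler_wpM2l ?mulr_ge0 ?(ltW (colsum_gt0 k))//.
have -> : gain x k =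
    \sum_e y e * a e k / mean z e / colsum k * (mean z e / mean x e).
  rewrite /gain mulr_suml; apply: eq_bigr => e _.
  have [->|ye] := eqVneq (y e) 0; first by rewrite !mul0r.
  by field; rewrite !gt_eqF// mean_gt0.
apply: jensen_ln => [e|e|].
- by rewrite !divr_ge0 ?mulr_ge0 ?mean_ge0// ltW.
- move=> w0; have ye : y e != 0 by apply: contraTneq w0 => ->; rewrite !mul0r ltxx.
  by rewrite divr_gt0// mean_gt0.
- by rewrite -mulr_suml; exact: zr.
Qed.

(** Convexity: the left-hand side is the differential at [x] applied to [z - x]. The bound is
    [ln_leB1] at [mean z e / mean x e]. *)
Lemma divergence_tangent x z : feasible x -> feasible z ->
  \sum_k colsum k * (1 - gain x k) * (z k - x k) <=
  divergence z - divergence x.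
Proof.
move=> fx fz; rewrite divergenceB//.
have -> : \sum_k colsum k * (1 - gain x k) * (z k - x k) =
    \sum_e y e * (1 - mean z e / mean x e) +
    \sum_k colsum k * z k - \sum_k colsum k * x k.
  transitivity (\sum_k (\sum_e y e * (a e k * x k / mean x e) -
      \sum_e y e * (a e k * z k / mean x e) +
      (colsum k * z k - colsum k * x k))).
    apply: eq_bigr => k _.
    rewrite -mul_colsum_em; set S := \sum_e _.
    have -> : S = colsum k * gain x k * z k; last by rewrite /em; ring.
    rewrite /gain mulrCA divff ?gt_eqF// mulr1 mulr_suml.
    by apply: eq_bigr => e _; ring.
  rewrite big_split/= sumrB [in X in _ + X]sumrB -[in RHS]addrA; congr (_ + _).
  rewrite exchange_big [X in _ - X = _]exchange_big/= -sumrB; apply: eq_bigr => e _.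
  rewrite -!mulr_sumr sum_mean_weight// -mulr_suml -/(mean z e).
  by rewrite mulrBr mulr1.
rewrite -!addrA lerD2r; apply: ler_sum => e _.
have [->|ye] := eqVneq (y e) 0; first by rewrite !mul0r.
have [mx mz] := (mean_gt0 fx ye, mean_gt0 fz ye).
rewrite ler_wpM2l//; have := ln_leB1 (divr_gt0 mz mx).
by rewrite !ln_div ?posrE//; move: (_ / _) => q; lra.
Qed.

End multiplicative_update.

(** * Subsequences, and limits read off square roots and divergences *)

Section sequence_lemmas.
Context {R : realType}.

Lemma increasing_seq_cvg (f : nat -> nat) : increasing_seq f -> f @ \oo --> \oo.
Proof.
move=> /increasing_seqP f_incr; have nf n : (n <= f n)%N.
  by elim: n => // n /leq_ltn_trans; apply; exact: f_incr.
by apply/cvgnyPge => A; near=> n; rewrite (leq_trans _ (nf n))//; near: n;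
  exact: nbhs_infty_ge.
Unshelve. all: by end_near. Qed.

Lemma cvg_sumr (I : finType) (u : nat -> I -> R) (l : I -> R) :
  (forall i, u^~ i @ \oo --> l i) ->
  \sum_i u n i @[n --> \oo] --> \sum_i l i.
Proof. by move=> ul; apply: cvg_big => //; exact: add_continuous. Qed.

Lemma sqr_cvg0 (u : R^nat) : u n ^+ 2 @[n --> \oo] --> 0 -> u @ \oo --> 0.
Proof.
move=> u0; apply: norm_cvg0.
have : Num.sqrt (u n ^+ 2) @[n --> \oo] --> Num.sqrt 0.
  by apply: continuous_cvg => //; exact: sqrt_continuous.
by rewrite sqrtr0; under eq_fun do rewrite sqrtr_sqr.
Qed.

Lemma sqrt_cvg (u : R^nat) l : (forall n, 0 <= u n) -> 0 <= l ->
  Num.sqrt (u n) @[n --> \oo] --> Num.sqrt l -> u @ \oo --> l.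
Proof.
move=> u0 l0 ul; rewrite -(sqr_sqrtr l0) expr2.
have -> : u = fun n => Num.sqrt (u n) * Num.sqrt (u n).
  by apply/funext => n; rewrite -expr2 sqr_sqrtr.
exact: cvgM.
Qed.

Lemma kldiv_cvg0 (p q : R^nat) : (forall n, 0 <= p n) -> (forall n, 0 <= q n) ->
  (forall n, q n = 0 -> p n = 0) -> kldiv (p n) (q n) @[n --> \oo] --> 0 ->
  Num.sqrt (p n) - Num.sqrt (q n) @[n --> \oo] --> 0.
Proof.
move=> p0 q0 qp pq; apply: sqr_cvg0.
apply: (squeeze_cvgr _ (cvg_cst 0) pq); apply: nearW => n.
by rewrite sqr_ge0 kldiv_ge_sqrt//; exact: qp.
Qed.

(** Dropping the summand [q] leaves [p * ln (p / q) <= C + p], solved for [q]. Bounded divergence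
    thus keeps [q] away from zero. *)
Lemma kldiv_le_lbound (p q C : R) : 0 < p -> 0 < q -> kldiv p q <= C ->
  p / expR ((C + p) / p) <= q.
Proof.
move=> p0 q0; rewrite ler_pdivrMr ?expR_gt0// mulrC -ler_pdivrMr// => pqC.
rewrite -[leLHS]lnK ?posrE ?divr_gt0// ler_expR ler_pdivlMr// mulrC.
by move: pqC; rewrite /kldiv; lra.
Qed.

(** Bolzano-Weierstrass coordinate by coordinate along [enum I], each extraction refining the
    previous one. *)
Lemma bounded_fin_subseq (I : finType) (u : nat -> I -> R) (M : I -> R) :
  (forall n i, `|u n i| <= M i) ->
  exists2 f : nat -> nat, increasing_seq f &
    exists l : I -> R, forall i, u (f n) i @[n --> \oo] --> l i.
Proof.
move=> uM.
suff [f fi fu] : exists2 f : nat -> nat, increasing_seq f &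
    forall i, i \in enum I -> cvgn (fun n => u (f n) i).
  exists f => //; exists (fun i => limn (fun n => u (f n) i)) => i.
  by apply: fu; rewrite mem_enum.
elim: (enum I) => [|i s [f fi fs]]; first by exists id.
have [|g gi gu] := @bolzano_weierstrass _ (fun n => u (f n) i).
  exists (M i); split; first exact: num_real.
  by move=> r Mr n _ /=; rewrite (le_trans (uM _ _))// ltW.
exists (f \o g) => [m n|j]; first exact: etrans (fi _ _) (gi _ _).
rewrite inE => /orP[/eqP->//|/fs/cvg_ex[l ul]]; apply/cvg_ex; exists l.
exact: (cvg_comp _ _ (increasing_seq_cvg gi) ul).
Qed.

End sequence_lemmas.

(** * Convergence of the iterates and optimality of the limit *)

Section multiplicative_update_limit.
Context {R : realType} {E I : finType} (a : E -> I -> R) (y : E -> R).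
Hypothesis a_ge0 : forall e k, 0 <= a e k.
Hypothesis y_ge0 : forall e, 0 <= y e.
Hypothesis colsum_gt0 : forall k, 0 < colsum a k.

Lemma cvg_mean (u : nat -> I -> R) z e : (forall k, u^~ k @ \oo --> z k) ->
  mean a (u n) e @[n --> \oo] --> mean a z e.
Proof. by move=> uz; apply: cvg_sumr => k; exact: cvgMr. Qed.

Lemma cvg_divergence (u : nat -> I -> R) z : feasible a y z ->
  (forall k, u^~ k @ \oo --> z k) ->
  divergence a y (u n) @[n --> \oo] --> divergence a y z.
Proof.
move=> [z0 zy] uz; apply: cvg_sumr => e; apply: cvg_kldiv => //.
- exact: mean_ge0.
- exact: zy.
- exact: cvg_mean.
Qed.

Lemma cvg_gain (u : nat -> I -> R) z k : feasible a y z ->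
  (forall k, u^~ k @ \oo --> z k) ->
  gain a y (u n) k @[n --> \oo] --> gain a y z k.
Proof.
move=> fz uz; apply: cvgMl; apply: cvg_sumr => e.
have [->|ye] := eqVneq (y e) 0.
  by rewrite !mul0r; under eq_fun do rewrite !mul0r; exact: cvg_cst.
apply: cvgMr; apply: cvgV; last exact: cvg_mean.
by rewrite gt_eqF// (mean_gt0 a_ge0 fz).
Qed.

(** By [kldiv_le_lbound], a mean with [y e > 0] stays above a positive constant and cannot vanish in
    the limit. *)
Lemma feasible_lim (u : nat -> I -> R) z C : (forall n, feasible a y (u n)) ->
  (forall n, divergence a y (u n) <= C) -> (forall k, u^~ k @ \oo --> z k) ->
  feasible a y z.
Proof.
move=> fu uC uz; split=> [k|e mz0].
  by apply: (cvgr_to_ge (uz k)); apply: nearW => n; have [] := fu n.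
apply/eqP/negPn/negP => ye; have y0 : 0 < y e by rewrite lt0r ye y_ge0.
have : y e / expR ((C + y e) / y e) <= mean a z e.
  have muz := @cvg_mean u z e uz.
  apply: (cvgr_to_ge muz); apply: nearW => n.
  have [u0 uy] := fu n; apply: kldiv_le_lbound => //; first exact: mean_gt0.
  apply: le_trans (uC n); rewrite /divergence (bigD1 e)//= lerDl.
  by apply: sumr_ge0 => i _; rewrite kldiv_ge0 ?mean_ge0//; exact: uy.
by rewrite mz0; apply/negP; rewrite -ltNge divr_gt0// expR_gt0.
Qed.

Variable x : nat -> I -> R.
Hypothesis feasible_x0 : feasible a y (x 0).
Hypothesis x_rec : forall t, x t.+1 = em a y (x t).

Lemma feasible_iter t : feasible a y (x t).
Proof. by elim: t => // t ft; rewrite x_rec; exact: feasible_em. Qed.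

Lemma iter_eq0 k t : x 0 k = 0 -> x t k = 0.
Proof. by move=> xk; elim: t => // t IH; rewrite x_rec /em IH mul0r. Qed.

Lemma iter_descent t :
  \sum_k colsum a k * kldiv (x t.+1 k) (x t k) <=
  divergence a y (x t) - divergence a y (x t.+1).
Proof. by rewrite x_rec; apply: divergence_em_le => //; exact: feasible_iter. Qed.

Lemma iter_step_ac t k : x t k = 0 -> x t.+1 k = 0.
Proof. by rewrite x_rec /em => ->; rewrite mul0r. Qed.

Lemma iter_kldiv_ge0 t k : 0 <= kldiv (x t.+1 k) (x t k).
Proof.
by apply: kldiv_ge0; [exact: (feasible_iter _).1| |exact: iter_step_ac];
  exact: (feasible_iter _).1.
Qed.

Lemma divergence_iter_nonincreasing : nonincreasing_seq (divergence a y \o x).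
Proof.
apply/nonincreasing_seqP => t /=; rewrite -subr_ge0.
apply: le_trans (iter_descent t); apply: sumr_ge0 => k _.
by rewrite mulr_ge0 ?iter_kldiv_ge0// ltW.
Qed.

Lemma is_cvg_divergence_iter : cvgn (divergence a y \o x).
Proof.
apply: (nonincreasing_is_cvgn divergence_iter_nonincreasing).
by exists 0 => _ [t _ <-]; apply: divergence_ge0 => //; exact: feasible_iter.
Qed.

(** The step divergences are dominated by consecutive differences of a convergent sequence; the
    Hellinger bound converts this to square roots. *)
Lemma iter_step_cvg0 k :
  Num.sqrt (x t.+1 k) - Num.sqrt (x t k) @[t --> \oo] --> 0.
Proof.
apply: kldiv_cvg0 => [t|t|t|]; [exact: (feasible_iter _).1| |exact: iter_step_ac|].
  exact: (feasible_iter _).1.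
have [l Fl] := (cvg_ex _).1 is_cvg_divergence_iter.
have dF0 : divergence a y (x t) - divergence a y (x t.+1) @[t --> \oo] --> 0.
  by rewrite -(subrr l); apply: cvgB => //; move: Fl; rewrite -cvg_shiftS.
have dF1 : (divergence a y (x t) - divergence a y (x t.+1)) / colsum a k
    @[t --> \oo] --> 0.
  by rewrite -(mul0r (colsum a k)^-1); exact: cvgMl.
apply: (squeeze_cvgr _ (cvg_cst 0) dF1); apply: nearW => t.
rewrite iter_kldiv_ge0 ler_pdivlMr// mulrC; apply: le_trans (iter_descent t).
rewrite [leRHS](bigD1 k)//= lerDl; apply: sumr_ge0 => i _.
by rewrite mulr_ge0 ?iter_kldiv_ge0// ltW.
Qed.

(** After one step, mass conservation bounds [colsum a k * x t k] by the total of [y]; the term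
    [x 0 k] covers the arbitrary start. *)
Lemma iter_bounded t k : `|x t k| <= x 0 k + (\sum_e y e) / colsum a k.
Proof.
rewrite ger0_norm ?(feasible_iter t).1//.
case: t => [|t]; first by rewrite lerDl divr_ge0 ?sumr_ge0// ltW.
apply: ler_wpDl; first exact: feasible_x0.1.
have ft := feasible_iter t.
rewrite ler_pdivlMr// mulrC -(sum_colsum_em a_ge0 colsum_gt0 ft) -x_rec.
rewrite [leRHS](bigD1 k)//= lerDl; apply: sumr_ge0 => i _.
by rewrite mulr_ge0 ?(feasible_iter _).1// ltW.
Qed.

Lemma iter_cvg : exists z, [/\ feasible a y z, em a y z = z,
  (forall k, x 0 k = 0 -> z k = 0) & forall k, x^~ k @ \oo --> z k].
Proof.
have [f f_incr [z xz]] := bounded_fin_subseq iter_bounded.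
have foo := increasing_seq_cvg f_incr.
have fz : feasible a y z.
  apply: (@feasible_lim (x \o f) _ (divergence a y (x 0))) => // n /=.
    exact: feasible_iter.
  exact: divergence_iter_nonincreasing.
have [z0 _] := fz.
have ac0 k : x 0 k = 0 -> z k = 0.
  move=> xk; have x0E : (fun n => x (f n) k) = fun=> 0.
    by apply/funext => n; exact: iter_eq0.
  have := xz k; rewrite x0E => zk; apply: (cvg_unique _ zk) => //.
  exact: cvg_cst.
have zfix : em a y z = z.
  apply/funext => k.
  (* The shifted subsequence has two limits: [em a y z k] by continuity, and [z k] because the steps
     vanish. *)
  have to_em : x (f n).+1 k @[n --> \oo] --> em a y z k.
    under eq_fun do rewrite x_rec /em.
    by apply: cvgM; [exact: xz|exact: cvg_gain].
  suff to_z : x (f n).+1 k @[n --> \oo] --> z k by exact: (cvg_unique _ to_em to_z).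
  apply: sqrt_cvg => // [n|]; first exact: (feasible_iter _).1.
  have st : Num.sqrt (x (f n) k) @[n --> \oo] --> Num.sqrt (z k).
    exact: (cvg_comp _ _ (xz k) (@sqrt_continuous R (z k))).
  have -> : (fun n => Num.sqrt (x (f n).+1 k)) = fun n =>
      Num.sqrt (x (f n).+1 k) - Num.sqrt (x (f n) k) + Num.sqrt (x (f n) k).
    by apply/funext => n; rewrite subrK.
  rewrite -[Num.sqrt (z k)]add0r; apply: cvgD st.
  exact: (cvg_comp _ _ foo (iter_step_cvg0 k)).
(* The divergence of [z] is the limit of the whole nonincreasing sequence. This makes the left-hand
   side of [em_fejer] nonnegative. *)
have Fz t : divergence a y z <= divergence a y (x t).
  have [l Fl] := (cvg_ex _).1 is_cvg_divergence_iter.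
  have -> : divergence a y z = l.
    have Fxz := cvg_divergence fz xz.
    apply: (cvg_unique _ Fxz) => //; exact: (cvg_comp _ _ foo Fl).
  have := nonincreasing_cvgn_ge divergence_iter_nonincreasing
    is_cvg_divergence_iter t.
  by rewrite (cvg_lim _ Fl).
(* An index killed by the update has zero gain everywhere, so the fixed point [z] vanishes there.
   Hence no [kldiv (z k) (x t k)] hides an infinite value. *)
have act t k : x t k = 0 -> z k = 0.
  elim: t => [|t IH]; first exact: ac0.
  move/eqP; rewrite x_rec mulf_eq0 => /orP[/eqP/IH//|/eqP rx].
  rewrite -zfix /em.
  by rewrite (gain_eq0 a_ge0 y_ge0 colsum_gt0 (feasible_iter t) rx) mulr0.
pose D t := \sum_k colsum a k * kldiv (z k) (x t k).
have kl0 t k : 0 <= kldiv (z k) (x t k).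
  by apply: kldiv_ge0 => //; [exact: (feasible_iter _).1|exact: act].
have D0 t : 0 <= D t by apply: sumr_ge0 => k _; rewrite mulr_ge0// ltW.
have D_ni : nonincreasing_seq D.
  apply/nonincreasing_seqP => t; rewrite -subr_ge0 -sumrB.
  under eq_bigr do rewrite -mulrBr x_rec.
  apply: le_trans (em_fejer a_ge0 y_ge0 colsum_gt0 _ fz _ (act t)).
  - by rewrite subr_ge0.
  - exact: feasible_iter.
  - by rewrite zfix.
have [l Dl] : exists l : R, D @ \oo --> l.
  apply/cvg_ex; apply: (nonincreasing_is_cvgn D_ni).
  by exists 0 => _ [t _ <-].
have l0 : l = 0.
  have Dfl : D (f n) @[n --> \oo] --> l by exact: (cvg_comp _ _ foo Dl).
  apply: (cvg_unique _ Dfl) => //.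
  have <- : \sum_k colsum a k * kldiv (z k) (z k) = 0.
    by apply: big1 => k _; rewrite kldivxx mulr0.
  by apply: cvg_sumr => k; apply: cvgMr; exact: cvg_kldiv.
exists z; split => // k.
apply: sqrt_cvg => // [t|]; first exact: (feasible_iter _).1.
have kl_cvg : kldiv (z k) (x t k) @[t --> \oo] --> 0.
  have Dk : D t / colsum a k @[t --> \oo] --> 0.
    by rewrite -(mul0r (colsum a k)^-1) -l0; exact: cvgMl.
  apply: (squeeze_cvgr _ (cvg_cst 0) Dk); apply: nearW => t.
  rewrite kl0 ler_pdivlMr// mulrC [leRHS](bigD1 k)//= lerDl.
  by apply: sumr_ge0 => i _; rewrite mulr_ge0// ltW.
have -> : (fun t => Num.sqrt (x t k)) = fun t =>
    Num.sqrt (z k) - (Num.sqrt (z k) - Num.sqrt (x t k)).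
  by apply/funext => t; rewrite subKr.
have dz : Num.sqrt (z k) - Num.sqrt (x t k) @[t --> \oo] --> 0.
  apply: (kldiv_cvg0 (fun=> z0 k) _ (fun t => act t k) kl_cvg) => t.
  exact: (feasible_iter _).1.
have := cvgB (cvg_cst (Num.sqrt (z k))) dz.
by rewrite subr0; apply.
Qed.

Lemma gain_lim_le1 z k : feasible a y z -> (forall k, x^~ k @ \oo --> z k) ->
  0 < x 0 k -> z k = 0 -> gain a y z k <= 1.
Proof.
move=> fz xz xk0 zk0; rewrite leNgt; apply/negP => rz.
(* Reaching zero would need a zero gain, which would carry over to [z] and contradict [rz]. *)
have xk t : 0 < x t k.
  elim: t => // t IH; rewrite x_rec mulr_gt0// lt0r gain_ge0// ?andbT; last first.
    exact: (feasible_iter _).1.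
  apply: contraTneq rz => rx.
  rewrite (gain_eq0 a_ge0 y_ge0 colsum_gt0 (feasible_iter t) rx) -leNgt.
  exact: ler01.
have [T _ rT] := cvgr_gt _ (cvg_gain fz xz) _ rz.
have incr n : x T k <= x (n + T)%N k.
  elim: n => // n /le_trans; apply; rewrite addSn x_rec ler_peMr ?(ltW (xk _))//.
  by apply/ltW/rT; exact: leq_addl.
suff : x T k <= z k by rewrite zk0 leNgt xk.
apply: (cvgr_to_ge (xz k)); exists T => // n /= Tn.
by rewrite -(subnK Tn); exact: incr.
Qed.

Lemma iter_cvg_minimizer : exists z,
  [/\ forall k, x^~ k @ \oo --> z k, feasible a y z,
      (forall k, x 0 k = 0 -> z k = 0) &
      forall w, feasible a y w -> (forall k, x 0 k = 0 -> w k = 0) ->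
        divergence a y z <= divergence a y w].
Proof.
have [z [fz zfix ac xz]] := iter_cvg.
exists z; split=> // w fw wac; rewrite -subr_ge0.
apply: le_trans (divergence_tangent a_ge0 y_ge0 colsum_gt0 fz fw).
(* Complementary slackness: [1 - gain a y z k] vanishes where [z k != 0]; elsewhere [w k = 0] or all
   factors are nonnegative. *)
apply: sumr_ge0 => k _.
have [zk0|zk0] := eqVneq (z k) 0; last first.
  have -> : gain a y z k = 1.
    by apply: (mulfI zk0); rewrite mulr1 -[RHS](congr1 (@^~ k) zfix).
  by rewrite subrr mulr0 mul0r.
rewrite zk0 subr0; have [xk0|xk0] := eqVneq (x 0 k) 0.
  by rewrite wac// mulr0.
rewrite !mulr_ge0 ?fw.1 ?(ltW (colsum_gt0 k))// subr_ge0.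
by apply: gain_lim_le1 => //; rewrite lt0r xk0 feasible_x0.1.
Qed.

End multiplicative_update_limit.

(** * Deconvolution as an instance indexed by pairs [(i, j)] *)

Lemma cvg_mx_coord (R : numFieldType) (p q : nat) (u : nat -> 'M[R]_(p, q))
    (l : 'M[R]_(p, q)) :
  (forall i j, u n i j @[n --> \oo] --> l i j) -> u @ \oo --> l.
Proof.
move=> ul A [P lP sPA]; rewrite /nbhs/=.
have : \forall n \near \oo, forall i j, P i j (u n i j).
  by apply: filter_forall => i; apply: filter_forall => j; exact: ul (lP i j).
by apply: filterS => n Pn; exact: sPA.
Qed.

Section deconvolution.
Context {R : realType} {N m : nat}.
Implicit Types (Y U : 'M[R]_(N.+1, m)) (h : 'cV[R]_N.+1).

(** The coefficient of [h k] in entry [e] of the model [toeplitz h *m U]. *)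
Definition conv_coef U (e : 'I_N.+1 * 'I_m) (k : 'I_N.+1) :=
  if (k <= e.1)%N then U (inord (e.1 - k)) e.2 else 0.

Definition entry Y (e : 'I_N.+1 * 'I_m) := Y e.1 e.2.

Definition coord h k := h k 0.

(** Substituting [l = i - k] turns a column sum into the normalizing constant of [update]. *)
Lemma sum_shift (G : 'I_N.+1 -> R) (k : 'I_N.+1) :
  \sum_(i < N.+1 | (k <= i)%N) G (inord (i - k)) =
  \sum_(l < N.+1 | (l <= N - k)%N) G l.
Proof.
rewrite (reindex_onto (fun l : 'I_N.+1 => inord (l + k))
  (fun i : 'I_N.+1 => inord (i - k))) /=; last first.
  move=> i ki; have ik : (i - k < N.+1)%N by rewrite (leq_ltn_trans (leq_subr _ _)).
  by apply/val_inj; rewrite /= (inordK ik) subnK// inordK.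
have lk (l : 'I_N.+1) : (l <= N - k)%N -> (l + k < N.+1)%N.
  by move=> lNk; rewrite ltnS addnC -leq_subRL// -ltnS.
apply: eq_big => [l|l].
  apply/andP/idP => [[kl /eqP/(congr1 val)/=]|lNk].
    rewrite inordK; last by rewrite (leq_ltn_trans (leq_subr _ _)).
    by move=> <-; rewrite leq_sub2r// -ltnS.
  by rewrite inordK ?lk// leq_addl addnK inord_val.
by move=> /andP[_ /eqP->].
Qed.

(** Commutativity of convolution: the matrix product runs over rows of [U], [mean] over entries of
    [h]. *)
Lemma sum_rev (i : 'I_N.+1) (G : 'I_N.+1 -> 'I_N.+1 -> R) :
  \sum_(k < N.+1 | (k <= i)%N) G (inord (i - k)) k =
  \sum_(k < N.+1 | (k <= i)%N) G k (inord (i - k)).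
Proof.
have ik (k : 'I_N.+1) : (i - k < N.+1)%N by rewrite (leq_ltn_trans (leq_subr _ _)).
rewrite (reindex_onto (fun k : 'I_N.+1 => inord (i - k))
  (fun k : 'I_N.+1 => inord (i - k))) /=; last first.
  by move=> k ki; apply/val_inj; rewrite /= inordK inordK ?subKn ?ik//.
apply: eq_big => [k|k /andP[_ /eqP->]//].
rewrite inordK ?ik// leq_subr /=; apply/eqP/idP => [/(congr1 val)/= <-|ki].
  by rewrite inordK ?leq_subr// (leq_ltn_trans (leq_subr _ _)).
by apply/val_inj; rewrite /= inordK ?subKn.
Qed.

Lemma conv_coef_ge0 U e k : nonneg_mx U -> 0 <= conv_coef U e k.
Proof. by move=> U0; rewrite /conv_coef; case: ifP. Qed.

Lemma mean_conv U h e :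
  mean (conv_coef U) (coord h) e =
  \sum_(p < N.+1 | (p <= e.1)%N) h p 0 * U (inord (e.1 - p)) e.2.
Proof.
rewrite [RHS]big_mkcond; apply: eq_bigr => k _.
by rewrite /conv_coef; case: ifP => _; rewrite ?mul0r// mulrC.
Qed.

Lemma mulmx_toeplitz U h e :
  (toeplitz h *m U) e.1 e.2 = mean (conv_coef U) (coord h) e.
Proof.
rewrite mean_conv -(sum_rev _ (fun k l => h k 0 * U l e.2)) mxE.
rewrite [RHS]big_mkcond; apply: eq_bigr => k _.
by rewrite mxE; case: ifP => _; rewrite ?mul0r.
Qed.

Lemma colsum_conv U k : colsum (conv_coef U) k =
  \sum_(l < N.+1 | (l <= N - k)%N) \sum_(j < m) U l j.
Proof.
rewrite -(sum_shift (fun l => \sum_(j < m) U l j)) big_mkcond.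
rewrite /colsum -(pair_bigA _ (fun i j => conv_coef U (i, j) k))/=.
by apply: eq_bigr => i _; rewrite /conv_coef/=; case: ifP => // _; rewrite big1.
Qed.

(** The row [l = 0] occurs in every column sum. *)
Lemma colsum_conv_gt0 U k : nonneg_mx U -> 0 < \sum_(j < m) U ord0 j ->
  0 < colsum (conv_coef U) k.
Proof.
move=> U0 U0_gt0; rewrite colsum_conv (bigD1 ord0)//=.
by rewrite ltr_wpDr// sumr_ge0// => i _; rewrite sumr_ge0.
Qed.

Lemma coord_update Y U h :
  coord (update Y U h) = em (conv_coef U) (entry Y) (coord h).
Proof.
apply/funext => k; rewrite /coord mxE /em /gain -colsum_conv mulrAC -mulrA.
congr (_ * (_ / _)).
rewrite -(pair_bigA _ (fun i j =>
  entry Y (i, j) * conv_coef U (i, j) k / mean (conv_coef U) (coord h) (i, j)))/=.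
rewrite [RHS]exchange_big/=; apply: eq_bigr => j _.
rewrite big_mkcond; apply: eq_bigr => i _; rewrite mean_conv /conv_coef/=.
by case: ifP => _ //; rewrite mulr0 mul0r.
Qed.

Lemma objectiveE Y U h : objective Y U h =
  if `[< forall e, mean (conv_coef U) (coord h) e = 0 -> entry Y e = 0 >]
  then (divergence (conv_coef U) (entry Y) (coord h))%:E else +oo%E.
Proof.
rewrite /objective /idiv; congr (if _ then _%:E else _).
  apply/forallP/asboolP => [H e|H i].
    move=> me; apply/eqP; move/forallP: (H e.1) => /(_ e.2)/implyP; apply.
    by rewrite mulmx_toeplitz me.
  apply/forallP => j; apply/implyP.
  by rewrite (mulmx_toeplitz U h (i, j)) => /eqP/H/eqP.
rewrite pair_bigA; apply: eq_bigr => e _.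
by rewrite mulmx_toeplitz.
Qed.

End deconvolution.

Theorem theoremV3 (R : realType) (N m : nat) (hm : (1 <= m)%N)
    (Y U : 'M[R]_(N.+1, m)) (hY : nonneg_mx Y) (hU : nonneg_mx U)
    (hU0 : 0 < \sum_(j < m) U ord0 j)
    (h : nat -> 'cV[R]_N.+1)
    (h0_ge0 : nonneg_mx (h 0%N))
    (h0_fin : (objective Y U (h 0%N) < +oo)%E)
    (h_rec : forall t : nat, h t.+1 = update Y U (h t)) :
  exists hoo : 'cV[R]_N.+1,
    [/\ h @ \oo --> hoo,
        minimizer_over (reachable (h 0%N)) (objective Y U) hoo &
        (forall k, 0 < h 0%N k 0) ->
          minimizer_over [set g | nonneg_mx g] (objective Y U) hoo].
Proof.
have feasible_h0 : feasible (conv_coef U) (entry Y) (coord (h 0%N)).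
  split=> [k|]; first exact: h0_ge0.
  by move: h0_fin; rewrite objectiveE; case: asboolP.
have [z [hz [z0 zY] ac z_min]] := iter_cvg_minimizer
  (fun e k => conv_coef_ge0 e k hU) (fun e => hY e.1 e.2 : 0 <= entry Y e)
  (fun k => colsum_conv_gt0 k hU hU0) feasible_h0
  (fun t => etrans (congr1 coord (h_rec t)) (coord_update Y U (h t))).
have zE : coord (\col_k z k) = z by apply/funext => k; rewrite /coord mxE.
have reach_min : minimizer_over (reachable (h 0%N)) (objective Y U) (\col_k z k).
  split=> [|g [g0 gac]].
    by split=> [k j|k]; rewrite mxE//; exact: ac.
  rewrite !objectiveE; case: asboolP => [_|]; last by rewrite zE.
  (* A competitor is either feasible or has infinite objective. *)
  case: asboolP => [gY|_]; last by rewrite leey.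
  rewrite lee_fin zE; apply: z_min => //; split=> // k; exact: g0.
exists (\col_k z k); split=> //.
  by apply: cvg_mx_coord => k j; rewrite mxE ord1; exact: hz.
move=> h0_gt0; have [[z_ge0 _] gmin] := reach_min.
(* With a positive start, the vanishing condition of [reachable] is vacuous. *)
split=> // g g0; apply: gmin; split=> // k hk.
by have := h0_gt0 k; rewrite hk ltxx.
Qed.
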